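(* Let $\imath(du)$ and $\jmath(dv)$ be probability measures on state spaces $\mathbb{U}$ and $\mathbb{V}$, let $P(u,dx)$ be a Markov transition from $\mathbb{U}$ to $\mathbb{X}$ and $Q(v,dy)$ a Markov transition from $\mathbb{V}$ to $\mathbb{Y}$. Let $J(u,dv)$ be a Markov transition from $\mathbb{U}$ to $\mathbb{V}$ with $\int \imath(du)J(u,dv)=\jmath(dv)$, and for each $(u,v)\in\mathbb{U}\times\mathbb{V}$ let $\mathbb{B}_{u,v}(x,dy)$ be a Markov transition from $\mathbb{X}$ to $\mathbb{Y}$ with $\int_{\mathbb{X}}P(u,dx)\mathbb{B}_{u,v}(x,dy)=Q(v,dy)$. Set $\pi(d(u,v)):=\imath(du)J(u,dv)$ and $\Pi((u,v),d(x,y)):=P(u,dx)\,\mathbb{B}_{u,v}(x,dy)$. Let $K(x,dy)$ be a Markov transition from $\mathbb{X}$ to $\mathbb{Y}$ and let $R((u,v),d(x,y)):=P(u,dx)K(x,dy)$. Assume that for $\pi$-almost every $(u,v)\in\mathbb{U}\times\mathbb{V}$, $$\Pi((u,v),\cdot)=\operatorname{arg\,min}\ \mathcal{H}\left(T((u,v),\cdot)\,|\,R((u,v),\cdot)\right),$$ where the minimum is over all Markov transitions $T((u,v),d(x,y))$ from $\mathbb{U}\times\mathbb{V}$ to $\mathbb{X}\times\mathbb{Y}$ such that $$\int_{y\in\mathbb{Y}}T((u,v),d(x,y))=P(u,dx)\quad\text{and}\quad \int_{x\in\mathbb{X}}T((u,v),d(x,y))=Q(v,dy).\qquad(\ast)$$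 Then $$\mathcal{H}\left(\pi\times\Pi\,|\,\pi\times R\right)=\inf_T\ \mathcal{H}\left(\pi\times T\,|\,\pi\times R\right),$$ where the infimum is taken over all Markov transitions $T$ from $\mathbb{U}\times\mathbb{V}$ to $\mathbb{X}\times\mathbb{Y}$ such that $(\ast)$ holds for every $(u,v)\in\mathbb{U}\times\mathbb{V}$.
   Context: For probability measures $Q,P$ on the same space, $\mathcal{H}(Q|P):=\int\log\left(\frac{dQ}{dP}\right)dQ$ is the relative entropy of $Q$ with respect to $P$ (with the usual convention $\mathcal{H}(Q|P)=+\infty$ if $Q$ is not absolutely continuous with respect to $P$). A Markov transition is a Markov (probability) kernel. For a probability measure $\mu$ and a Markov transition $K$, $\mu\times K$ denotes the probability measure $(\mu\times K)(d(x,y)):=\mu(dx)K(x,dy)$; thus $(\pi\times T)(d((u,v),(x,y)))=\pi(d(u,v))\,T((u,v),d(x,y))$.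
   Formalization: The state spaces X and Y are assumed to have countably generated sigma-algebras (as every Polish space does), because the claim fails for arbitrary measurable spaces; U and V are arbitrary. *)

(* Defs.v *)
From HB Require Import structures.
From mathcomp Require Import all_boot all_order all_algebra.
From mathcomp Require Import all_classical all_reals all_analysis.
From mathcomp Require Import measurable_realfun.

Set Implicit Arguments.
Unset Strict Implicit.
Unset Printing Implicit Defensive.

Import Order.TTheory GRing.Theory Num.Theory.
Import numFieldNormedType.Exports.

Local Open Scope classical_set_scope.
Local Open Scope ring_scope.
Local Open Scope ereal_scope.
Local Open Scope charge_scope.

(* Satisfied in particular by the Borel sigma-algebra of every separable
   metric (e.g. Polish) space. *)
Definition countably_generated (d : measure_display) (T : measurableType d) :
    Prop :=
  exists2 G : set (set T), countable G & (@measurable d T) = <<s G >>.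

(* When Q is not absolutely continuous, the library's Radon-Nikodym derivative
   is a dummy constant, hence the case distinction. *)
Definition relative_entropy (d : measure_display) (T : measurableType d)
    (R : realType) (Q P : probability T R) : \bar R :=
  if `[< Q `<< P >] then
    \int[Q]_x lne (('d (charge_of_finite_measure Q) '/d P) x)
  else +oo.

Definition argmin (S : Type) (R : realType) (C : set S) (f : S -> \bar R) :
    set S :=
  [set x | C x /\ forall y, C y -> f x <= f y].

Section kernel_at.
Context d d' (X : measurableType d) (Y : measurableType d') (R : realType).
Variables (K : R.-pker X ~> Y) (x : X).

(* The measure K(x, .), packaged as a probability. *)
Definition kernel_at : set Y -> \bar R := K x.

HB.instance Definition _ := Measure.copy kernel_at (K x).

Let kernel_at_setT : kernel_at [set: Y] = 1.
Proof. exact: prob_kernel. Qed.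

HB.instance Definition _ := Measure_isProbability.Build _ _ _ kernel_at
  kernel_at_setT.

End kernel_at.

Section kernel_product.
Context d d' (X : measurableType d) (Y : measurableType d') (R : realType).
Variables (mu : probability X R) (K : R.-pker X ~> Y).

(* The probability (mu x K)(d(x, y)) = mu(dx) K(x, dy) on X * Y. *)
Definition kernel_product (A : set (X * Y)) : \bar R :=
  \int[mu]_x K x (xsection A x).

Let kernel_product0 : kernel_product set0 = 0.
Proof.
by apply: integral0_eq => x _; rewrite xsection0 measure0.
Qed.

Let kernel_product_ge0 A : 0 <= kernel_product A.
Proof. by apply: integral_ge0 => x _; exact: measure_ge0. Qed.

Let kernel_product_sigma_additive : semi_sigma_additive kernel_product.
Proof.
move=> F mF tF mUF.
rewrite [X in _ --> X](_ : _ =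
    \sum_(0 <= n <oo) kernel_product (F n)); last first.
  rewrite /kernel_product -integral_nneseries//; last first.
    by move=> n; apply: (measurable_fun_xsection_finite_kernel K); rewrite inE.
  apply: eq_integral => x _; rewrite xsection_bigcup; apply/esym/cvg_lim => //.
  apply: measure_sigma_additive; last exact: trivIset_xsection.
  by move=> n; exact: measurable_xsection (mF n).
by apply: is_cvg_nneseries => n _ _; exact: kernel_product_ge0.
Qed.

HB.instance Definition _ := isMeasure.Build _ _ _ kernel_product
  kernel_product0 kernel_product_ge0 kernel_product_sigma_additive.

Let kernel_product_setT : kernel_product [set: X * Y] = 1.
Proof.
rewrite /kernel_product (eq_integral (cst 1)).
  by rewrite integral_cst// mul1e; exact: probability_setT.
by move=> x _; rewrite xsectionE preimage_setT prob_kernel.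
Qed.

HB.instance Definition _ := Measure_isProbability.Build _ _ _ kernel_product
  kernel_product_setT.

End kernel_product.

Section reference_kernel.
Context dU dV dX dY (U : measurableType dU) (V : measurableType dV)
  (X : measurableType dX) (Y : measurableType dY) (R : realType).
Variables (P : R.-pker U ~> X) (K : R.-pker X ~> Y).

(* The transition ((u, v), d(x, y)) |-> P(u, dx) K(x, dy). *)
Definition reference_kernel (w : U * V) : {measure set (X * Y) -> \bar R} :=
  kernel_product (kernel_at P w.1) K.

Let measurable_reference_kernel A : measurable A ->
  measurable_fun [set: U * V] (reference_kernel ^~ A).
Proof.
move=> mA; rewrite /reference_kernel /= /kernel_product.
apply: (@measurable_fun_integral_kernel _ _ _ _ _ (fun w : U * V => P w.1)).
- move=> B mB.
  by apply: (measurableT_comp (measurable_kernel P B mB)); exact: measurable_fst.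
- by [].
- by apply: (measurable_fun_xsection_finite_kernel K); rewrite inE.
Qed.

HB.instance Definition _ := isKernel.Build _ _ _ _ _ reference_kernel
  measurable_reference_kernel.

Let reference_kernel_setT w : reference_kernel w [set: X * Y] = 1.
Proof. exact: probability_setT. Qed.

HB.instance Definition _ := Kernel_isProbability.Build _ _ _ _ _
  reference_kernel reference_kernel_setT.

End reference_kernel.

(* T((u, v), .) is a coupling of P(u, .) and Q(v, .). Measures are compared on
   measurable sets only: their values elsewhere are not meaningful. *)
Definition has_marginals (dU dV dX dY : measure_display)
    (U : measurableType dU) (V : measurableType dV)
    (X : measurableType dX) (Y : measurableType dY) (R : realType)
    (P : R.-pker U ~> X) (Q : R.-pker V ~> Y)
    (T : R.-pker (U * V) ~> (X * Y)%type) (u : U) (v : V) : Prop :=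
  (forall A : set X, measurable A -> T (u, v) (A `*` [set: Y]) = P u A) /\
  (forall B : set Y, measurable B -> T (u, v) ([set: X] `*` B) = Q v B).

(* Main.v *)
Require Import Defs.
From HB Require Import structures.
From mathcomp Require Import finmap.
From mathcomp Require Import all_boot all_order all_algebra.
From mathcomp Require Import all_classical all_reals all_analysis.
From mathcomp Require Import measurable_realfun.

Set Implicit Arguments.
Unset Strict Implicit.
Unset Printing Implicit Defensive.

Import Order.TTheory GRing.Theory Num.Theory.

Local Open Scope classical_set_scope.
Local Open Scope ring_scope.
Local Open Scope ereal_scope.
Local Open Scope charge_scope.

(** The relative entropy of [pi x T] with respect to [pi x R] disintegrates
    into the [pi]-average of the entropies of the fibres [T_w] with respect to
    [R_w], and this average is monotone in the fibres. As [Pi] has the smallest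
    fibre entropies for [pi]-almost every [w], it has the smallest entropy among
    all kernels [T] with the prescribed marginals; being one of them, it attains
    the infimum.

    The disintegration formula ([relative_entropy_chain_rule]) rests on two
    facts.
    - If [f] is a density of [Q] with respect to [P], then
      [H(Q|P) + 1 = \int (f ln f + 1) dP] ([relative_entropy_density]). Since
      [t ln t + 1 >= 0], every integral that occurs is that of a nonnegative
      function: Tonelli's theorem for [pi x K] ([integral_kernel_product])
      applies without any integrability condition, and the formula remains
      valid when the entropy is infinite.
    - A density [f] of [pi x T] with respect to [pi x R] has sections [f(w, .)]
      that are densities of [T_w] with respect to [R_w] for almost every [w]
      ([ae_kernel_density]). For one measurable set [A], integrating over
      arbitrary sets of [w] shows that [T_w(A)] is the integral of [f(w, .)]
      over [A], outside a null set that depends on [A]. A countable generating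
      pi-system makes the null set uniform in [A]; this is where countable
      generation of the state spaces is used.

    The chain rule requires [pi x T << pi x R]. When the competitor [T] has
    finite entropy this holds, and it passes to [Pi]: almost all fibre
    entropies of [T] are finite, those of [Pi] are no larger, hence
    [Pi_w << R_w] for almost every [w], which integrates to
    [pi x Pi << pi x R] ([kernel_product_dominates]). *)

(** * Countable generation *)

Lemma countably_generated_prod d1 d2 (T1 : measurableType d1)
    (T2 : measurableType d2) :
  countably_generated T1 -> countably_generated T2 ->
  countably_generated (T1 * T2)%type.
Proof.
move=> [G1 cG1 E1] [G2 cG2 E2].
pose H1 := preimage_set_system [set: T1 * T2] fst G1.
pose H2 := preimage_set_system [set: T1 * T2] snd G2.
exists (H1 `|` H2).
  rewrite -bigcup2E; apply: bigcup_countable => // -[|[|n]] _ //=;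
    rewrite ?/preimage_set_system; exact: (card_le_trans (card_image_le _ _)).
rewrite eqEsubset; split.
  apply: smallest_sub; first exact: smallest_sigma_algebra.
  rewrite E1 E2 subUset; split.
  - rewrite -g_sigma_preimageE; exact: sub_smallest2r.
  - rewrite -g_sigma_preimageE; exact: sub_smallest2r.
apply: smallest_sub; first exact: sigma_algebra_measurable.
rewrite subUset; split => _ [A GA <-].
- by apply: measurable_fst => //; rewrite E1; exact: sub_sigma_algebra.
- by apply: measurable_snd => //; rewrite E2; exact: sub_sigma_algebra.
Qed.

(** Finite intersections of a countable family form a countable family; the
    empty intersection supplies the full set. *)
Lemma countable_generating_pi_system d (T : measurableType d) :
  countably_generated T ->
  exists G : set (set T),
    [/\ countable G, setI_closed G, G setT & @measurable d T = <<s G >>].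
Proof.
move=> [G cG GE]; exists (finI_from G id); split.
- exact: finI_from_countable.
- by move=> A B; exact: finI_fromI.
- by exists fset0 => //; rewrite set_fset0 bigcap_set0.
rewrite eqEsubset; split.
  rewrite GE; apply: sub_smallest2r; first exact: smallest_sigma_algebra.
  by move=> A GA; exact: finI_from1.
apply: smallest_sub; first exact: sigma_algebra_measurable.
move=> _ [F FG <-]; apply: fin_bigcap_measurable; first exact: finite_fset.
by move=> A /= /FG; rewrite inE GE => GA; exact: sub_sigma_algebra.
Qed.

(** * Integration against a kernel product *)

Section integral_kernel_product.
Context d d' (X : measurableType d) (Y : measurableType d') (R : realType).
Variables (mu : probability X R) (K : R.-pker X ~> Y).

(** The image of [K x] on the slice over [x], with [x = w.2]. Its composition
    with the constant kernel [mu] on [unit] is [mu x K]; the [unit] factor is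
    the parameter space that kernel composition asks for. *)
Definition section_kernel (w : unit * X) : {measure set (X * Y) -> \bar R} :=
  kernel_product \d_w.2 K.

Let section_kernelE w A : measurable A ->
  section_kernel w A = K w.2 (xsection A w.2).
Proof.
move=> mA; rewrite /section_kernel /= /kernel_product integral_dirac//.
  by rewrite diracT mul1e.
by apply: (measurable_fun_xsection_finite_kernel K); rewrite inE.
Qed.

Let measurable_section_kernel A : measurable A ->
  measurable_fun [set: unit * X] (section_kernel ^~ A).
Proof.
move=> mA.
have -> : section_kernel ^~ A = (fun x => K x (xsection A x)) \o snd.
  by apply/funext => w; exact: section_kernelE.
apply: measurableT_comp; last exact: measurable_snd.
by apply: (measurable_fun_xsection_finite_kernel K); rewrite inE.
Qed.

HB.instance Definition _ := isKernel.Build _ _ _ _ _ section_kernel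
  measurable_section_kernel.

Let section_kernel_setT w : section_kernel w [set: X * Y] = 1.
Proof. exact: probability_setT. Qed.

HB.instance Definition _ := Kernel_isProbability.Build _ _ _ _ _
  section_kernel section_kernel_setT.

(** Tonelli's theorem for [mu x K], read off from the integration formula for
    composed kernels. *)
Lemma integral_kernel_product (f : X * Y -> \bar R) :
  (forall z, 0 <= f z) -> measurable_fun setT f ->
  \int[kernel_product mu K]_z f z = \int[mu]_x \int[K x]_y f (x, y).
Proof.
move=> f0 mf.
pose l := kprobability
  (@measurable_cst _ _ unit _ setT (mu : pprobability X R)).
transitivity (\int[kcomp l section_kernel tt]_z f z).
  apply: eq_measure_integral => A mA _.
  by apply: eq_integral => x _; rewrite section_kernelE.
rewrite integral_kcomp//; apply: eq_integral => x _.
have mpx := @pair1_measurable _ _ X Y x.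
transitivity (\int[pushforward (K x) (pair x)]_z f z).
  apply: eq_measure_integral => A mA _.
  by rewrite section_kernelE//= /pushforward xsectionE.
by rewrite (ge0_integral_pushforward mpx)// preimage_setT.
Qed.

End integral_kernel_product.

(** * Relative entropy in terms of a density *)

(** From [ln (1/t) <= 1/t - 1] for positive [t]; elsewhere [ln t = 0]. The
    constant 1 is what makes entropy integrands nonnegative. *)
Lemma mul_ln_add1_ge0 (R : realType) (t : R) : (0 <= t * ln t + 1)%R.
Proof.
have [t0|t0] := leP t 0%R; first by rewrite ln0// mulr0 add0r.
have := @le_ln1Dx R (t^-1 - 1)%R.
rewrite ltrBrDr addNr invr_gt0 => /(_ t0).
rewrite [(1 + _)%R]addrC subrK lnV ?posrE// -(ler_pM2l t0).
rewrite mulrBr divff ?gt_eqF// mulr1 mulrN lerNl opprB => h.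
by rewrite -lerBlDr sub0r (le_trans _ h)// lerBrDr addNr ltW.
Qed.

Lemma measurable_fun_lne d (T : measurableType d) (R : realType)
    (g : T -> \bar R) :
  (forall x, g x \is a fin_num) ->
  measurable_fun setT g -> measurable_fun setT (fun x => lne (g x)).
Proof.
move=> gfin mg.
have mfg : measurable_fun setT (fine \o g) by apply: measurableT_comp.
have -> : (fun x => lne (g x)) = (fun x => if (fine (g x) <= 0)%R then -oo
    else (ln (fine (g x)))%:E).
  by apply/funext => x; rewrite -{1}(fineK (gfin x)).
apply: measurable_fun_ifT => //.
- by apply: measurable_fun_ler => //.
- by apply/measurable_EFinP/measurableT_comp.
Qed.

Section density.
Context d (T : measurableType d) (R : realType).
Implicit Types (Q P : probability T R) (f : T -> R).

(** Densities are finite and nonnegative everywhere, so that [f * ln f] is a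
    real-valued function of the density. *)
Definition is_density Q P f :=
  [/\ forall x, (0 <= f x)%R, measurable_fun setT f &
      forall A, measurable A -> Q A = \int[P]_(x in A) (f x)%:E].

Lemma density_exists Q P : Q `<< P -> exists f, is_density Q P f.
Proof.
move=> QP; have [g [g0 gfin intg Qg]] := radon_nikodym_sigma_finite QP.
exists (fine \o g); split.
- by move=> x; exact/fine_ge0.
- by apply/measurable_EFinP; rewrite (_ : _ \o _ = g);
    [exact: measurable_int intg|apply/funext => x /=; rewrite fineK].
- by move=> A mA; rewrite Qg//; apply: eq_integral => x _ /=; rewrite fineK.
Qed.

Lemma density_dominates Q P f : is_density Q P f -> Q `<< P.
Proof.
move=> [f0 mf Qf]; apply/null_content_dominatesP => A mA PA.
rewrite Qf//; apply: null_set_integral => //.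
by apply/measurable_funTS/measurable_EFinP.
Qed.

Lemma integral_density Q P f (h : T -> \bar R) : is_density Q P f ->
  (forall x, 0 <= h x) -> measurable_fun setT h ->
  \int[Q]_x h x = \int[P]_x (h x * (f x)%:E).
Proof.
move=> Qf h0 mh; have QP := density_dominates Qf; case: Qf => f0 mf Qf.
rewrite -(Radon_Nikodym_SigmaFinite.change_of_variables QP)//.
have intg := Radon_Nikodym_SigmaFinite.f_integrable QP.
have mg := measurable_int _ intg.
apply: ae_eq_integral => //.
- exact: emeasurable_funM.
- by apply: emeasurable_funM => //; exact/measurable_EFinP.
apply: ae_eqe_mul2l; apply: integral_ae_eq => //; first exact/measurable_EFinP.
move=> A _ mA; rewrite -Qf//.
by rewrite -Radon_Nikodym_SigmaFinite.f_integral.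
Qed.

(** Both sides are compared through the positive and negative parts of
    [f ln f]: the change of variables [dQ = f dP] turns those of [ln f] into
    them, and the negative part has a finite integral because it is at most 1.
    Only the positive part may then be infinite, and it is on both sides. *)
Lemma relative_entropy_density Q P f : is_density Q P f ->
  relative_entropy Q P + 1 = \int[P]_x (f x * ln (f x) + 1)%:E.
Proof.
move=> Qf; have QP := density_dominates Qf.
have cQP : charge_of_finite_measure Q `<< P by exact: QP.
have [f0 mf QfE] := Qf.
have mlnf : measurable_fun setT (fun x => ln (f x)).
  exact: measurableT_comp.
have mphi : measurable_fun setT (fun x => (f x * ln (f x))%R).
  exact: measurable_funM.
have RNf : ae_eq Q setT ('d (charge_of_finite_measure Q) '/d P) (EFin \o f).
  apply: null_dominates_ae_eq QP _ => //.
  apply: integral_ae_eq => //.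
  - exact: Radon_Nikodym_integrable.
  - exact/measurable_EFinP.
  by move=> A _ mA; rewrite -QfE// -Radon_Nikodym_integral.
(* [Q] does not charge the zeros of its density, the only points where [lne]
   and [ln] of the density differ. *)
have f_gt0 : {ae Q, forall x, (0 < f x)%R}.
  have mE : measurable [set x | f x = 0%R].
    by rewrite -[X in measurable X]setTI; exact: (mf measurableT [set 0%R]).
  exists [set x | f x = 0%R]; split => //.
    by rewrite QfE//; apply: integral0_eq => x /= ->.
  by move=> x /= /negP; rewrite -leNgt => fx0; apply/eqP; rewrite eq_le fx0 f0.
have HE : relative_entropy Q P = \int[Q]_x (ln (f x))%:E.
  rewrite /relative_entropy asboolT//; apply: ae_eq_integral => //.
  - apply: measurable_fun_lne => // x; exact: Radon_Nikodym_fin_num.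
  - exact/measurable_EFinP.
  - by apply: filterS2 RNf f_gt0 => x /(_ I) -> fx _; exact: lne_EFin.
pose phi x := (f x * ln (f x))%:E.
have {}HE : relative_entropy Q P = \int[P]_x phi x.
  rewrite HE integralE [RHS]integralE; congr (_ - _).
  - rewrite (integral_density Qf)//; last first.
      exact/measurable_funepos/measurable_EFinP.
    apply: eq_integral => x _; rewrite !funeposE /phi mulrC EFinM.
    by rewrite maxe_pMl ?lee_fin// mul0e.
  - rewrite (integral_density Qf)//; last first.
      exact/measurable_funeneg/measurable_EFinP.
    apply: eq_integral => x _; rewrite !funenegE /phi mulrC EFinM.
    by rewrite maxe_pMl ?lee_fin// mul0e mulNe.
have mphiE : measurable_fun setT phi by exact/measurable_EFinP.
have neg_le1 x : phi^\- x <= 1.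
  rewrite funenegE ge_max lee01 andbT leeNl lee_fin -subr_ge0 opprK.
  exact: mul_ln_add1_ge0.
have neg_fin : \int[P]_x phi^\- x \is a fin_num.
  rewrite ge0_fin_numE ?integral_ge0//.
  rewrite (@le_lt_trans _ _ (\int[P]_x (cst 1 x)))//.
    by apply: ge0_le_integral => //; exact: measurable_funeneg.
  rewrite integral_cst// mul1e [ltLHS](_ : _ = 1) ?ltry//.
  exact: probability_setT.
have add_neg : \int[P]_x (f x * ln (f x) + 1)%:E + \int[P]_x phi^\- x =
    \int[P]_x phi^\+ x + 1.
  have <- : \int[P]_x (cst 1 x) = 1.
    by rewrite integral_cst// mul1e; exact: probability_setT.
  rewrite -!ge0_integralD//.
  - apply: eq_integral => x _; rewrite EFinD -/(phi x) {1}(funeposneg phi).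
    have ngfin : phi^\- x \is a fin_num.
      by rewrite ge0_fin_numE// (le_lt_trans (neg_le1 x))// ltry.
    by rewrite addeAC subeK.
  - exact: measurable_funepos.
  - by move=> x _; rewrite lee_fin mul_ln_add1_ge0.
  - by apply/measurable_EFinP; exact: measurable_funD.
  - exact: measurable_funeneg.
by rewrite HE [X in X + 1]integralE addeAC -add_neg addeK.
Qed.

End density.

(** * Densities of the fibres of a kernel *)

Section density_measure.
Context d (T : measurableType d) (R : realType).
Variables (P : probability T R) (f : T -> R).
Hypotheses (f0 : forall x, (0 <= f x)%R) (mf : measurable_fun setT f).

(** Uniqueness of measures on a pi-system compares two measures, so the
    indefinite integral of [f] is needed as one. *)
Definition density_measure (A : set T) : \bar R := \int[P]_(x in A) (f x)%:E.

Let density_measure0 : density_measure set0 = 0.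
Proof. exact: integral_set0. Qed.

Let density_measure_ge0 A : 0 <= density_measure A.
Proof. by apply: integral_ge0 => x _; rewrite lee_fin. Qed.

Let density_measure_sigma_additive : semi_sigma_additive density_measure.
Proof.
apply: semi_sigma_additive_nng_induced; first exact/measurable_EFinP.
by move=> x; rewrite lee_fin.
Qed.

HB.instance Definition _ := isMeasure.Build _ _ _ density_measure
  density_measure0 density_measure_ge0 density_measure_sigma_additive.

Lemma is_density_pi_system (Q : probability T R) (G : set (set T)) :
  @measurable d T = <<s G >> -> setI_closed G -> G setT ->
  (forall A, G A -> Q A = \int[P]_(x in A) (f x)%:E) -> is_density Q P f.
Proof.
move=> GE GI GT QG; split=> // A mA.
apply: (@measure_unique _ _ _ G (fun=> setT) GE GI _ _ Q density_measure) => //.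
  by rewrite bigcup_const.
by move=> _; rewrite -ge0_fin_numE// fin_num_measure.
Qed.

End density_measure.

Section kernel_density.
Context dW dZ (W : measurableType dW) (Z : measurableType dZ) (R : realType).
Variables (pi : probability W R).
Implicit Types T S : R.-pker W ~> Z.

Lemma kernel_product_setX T (E : set W) (A : set Z) :
  measurable E -> measurable A ->
  kernel_product pi T (E `*` A) = \int[pi]_(w in E) T w A.
Proof.
move=> mE mA; rewrite [RHS]integral_mkcond /= /kernel_product.
apply: eq_integral => w _; rewrite patchE.
by case: ifPn => wE; [rewrite in_xsectionX|rewrite notin_xsectionX ?measure0].
Qed.

Lemma integral_kernel_product_setX T (f : W * Z -> \bar R) (E : set W)
    (A : set Z) : (forall x, 0 <= f x) -> measurable_fun setT f ->
  measurable E -> measurable A ->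
  \int[kernel_product pi T]_(x in E `*` A) f x =
  \int[pi]_(w in E) \int[T w]_(z in A) f (w, z).
Proof.
move=> f0 mf mE mA.
rewrite integral_mkcond integral_kernel_product; last 2 first.
- by move=> z; rewrite patchE; case: ifP.
- apply/measurable_restrict => //; first exact: measurableX.
  exact: measurable_funTS.
rewrite [RHS]integral_mkcond; apply: eq_integral => w _; rewrite patchE.
case: ifPn => wE.
- rewrite [RHS]integral_mkcond; apply: eq_integral => z _.
  by rewrite !patchE in_setX /= wE.
- by apply: integral0_eq => z _; rewrite patchE in_setX /= (negbTE wE).
Qed.

Lemma ae_forall_countable (I : Type) (G : set I) (Q : I -> W -> Prop) :
  countable G ->
  (forall A, G A -> {ae pi, forall w, Q A w}) ->
  {ae pi, forall w, forall A, G A -> Q A w}.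
Proof.
have [->|/set0P[A0 GA0]] := eqVneq G set0; first by move=> _ _; exact: aeW.
move=> /pfcard_geP[G0|[g]] GQ; first by move: GA0; rewrite G0.
have : {ae pi, forall w n, Q (g n) w}.
  by apply/ae_foralln => n; apply: GQ; exact: funS.
apply: filterS => w Qw A GA.
by have [n _ <-] := @surj _ _ _ _ g A GA; exact: Qw.
Qed.

(** For a fixed [A], the functions [T_w(A)] and [\int_A f(w, .) dS_w] of [w]
    have the same integral over every measurable set [E], namely the mass of
    [E x A] under [pi x T], so they agree almost everywhere. *)
Lemma ae_kernel_density T S (f : W * Z -> R) : countably_generated Z ->
  is_density (kernel_product pi T) (kernel_product pi S) f ->
  {ae pi, forall w,
     is_density (kernel_at T w) (kernel_at S w) (fun z => f (w, z))}.
Proof.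
move=> /countable_generating_pi_system[G [cG GI GT GE]] [f0 mf TSf].
have mEf : measurable_fun setT (EFin \o f) by exact/measurable_EFinP.
have Gm A : G A -> measurable A by rewrite GE; exact: sub_sigma_algebra.
suff : {ae pi, forall w A, G A -> T w A = \int[S w]_(z in A) (f (w, z))%:E}.
  apply: filterS => w TSw; apply: is_density_pi_system GE GI GT _ => //.
  exact: measurable_fun_pair2.
apply: ae_forall_countable => // A /Gm mA.
suff : ae_eq pi setT (T ^~ A) (fun w => \int[S w]_(z in A) (f (w, z))%:E).
  by apply: filterS => w /(_ I).
have mT : measurable_fun setT (T ^~ A) by exact: measurable_kernel.
apply: integral_ae_eq => //.
- apply: (@le_integrable _ _ _ _ _ _ _ (cst 1)) => //.
    move=> w _; rewrite !gee0_abs// ?lee01//.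
    exact: (probability_le1 (kernel_at T w)).
  by apply: finite_measure_integrable_cst.
- have -> : (fun w => \int[S w]_(z in A) (f (w, z))%:E) =
      (fun w => \int[S w]_z ((EFin \o f) \_ (setT `*` A)) (w, z)).
    apply/funext => w; rewrite integral_mkcond; apply: eq_integral => z _.
    by rewrite !patchE in_setX /= in_setT.
  apply: (@measurable_fun_integral_finite_kernel _ _ _ _ _ _ S).
  + by move=> x; rewrite patchE; case: ifP => //; rewrite lee_fin.
  + apply/measurable_restrict => //; first exact: measurableX.
    exact: measurable_funTS.
- move=> E _ mE.
  rewrite -kernel_product_setX// TSf; last exact: measurableX.
  exact: (@integral_kernel_product_setX S (EFin \o f) E A).
Qed.

End kernel_density.

(** * The chain rule and its consequences *)

Section entropy_chain_rule.
Context dW dZ (W : measurableType dW) (Z : measurableType dZ) (R : realType).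
Variables (pi : probability W R).
Implicit Types T S : R.-pker W ~> Z.

(** The fibrewise entropy agrees with a measurable function [h] almost
    everywhere, which avoids proving that it is itself measurable in [w]. The
    shift by 1 keeps [h] nonnegative. *)
Lemma relative_entropy_chain_rule T S : countably_generated Z ->
  kernel_product pi T `<< kernel_product pi S ->
  exists h : W -> \bar R,
    [/\ forall w, 0 <= h w, measurable_fun setT h,
      {ae pi, forall w,
         relative_entropy (kernel_at T w) (kernel_at S w) + 1 = h w} &
      relative_entropy (kernel_product pi T) (kernel_product pi S) + 1 =
      \int[pi]_w h w].
Proof.
move=> cgZ /density_exists[f fTS].
have [f0 mf _] := fTS.
pose phi z := (f z * ln (f z) + 1)%:E.
have phi0 z : 0 <= phi z by rewrite lee_fin mul_ln_add1_ge0.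
have mphi : measurable_fun setT phi.
  apply/measurable_EFinP; apply: measurable_funD => //.
  by apply: measurable_funM => //; exact: measurableT_comp.
exists (fun w => \int[S w]_z phi (w, z)); split.
- by move=> w; exact: integral_ge0.
- exact: (@measurable_fun_integral_finite_kernel _ _ _ _ _ _ S).
- apply: filterS (ae_kernel_density cgZ fTS) => w fw.
  exact: relative_entropy_density fw.
- by rewrite (relative_entropy_density fTS) integral_kernel_product.
Qed.

Lemma kernel_product_dominates T S :
  {ae pi, forall w, kernel_at T w `<< kernel_at S w} ->
  kernel_product pi T `<< kernel_product pi S.
Proof.
move=> TS; apply/null_content_dominatesP => A mA SA0.
have mK (K : R.-pker W ~> Z) :
    measurable_fun setT (fun w => K w (xsection A w)).
  by apply: (measurable_fun_xsection_finite_kernel K); rewrite inE.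
have : ae_eq pi setT (fun w => S w (xsection A w)) (cst 0).
  apply/(ae_eq_integral_abs _ measurableT (mK S)).
  rewrite -[RHS]SA0; apply: eq_integral => w _; exact: gee0_abs.
move=> S0; rewrite -[RHS](integral0 pi setT); apply: ae_eq_integral => //.
apply: filterS2 TS S0 => w /null_content_dominatesP TSw /(_ I) /= Sw0 _.
by apply: TSw => //; exact: measurable_xsection.
Qed.

Lemma relative_entropy_lty_dominates d (T : measurableType d)
    (Q P : probability T R) : relative_entropy Q P < +oo -> Q `<< P.
Proof. by rewrite /relative_entropy; case: asboolP. Qed.

(** Integrating the fibrewise inequality through the chain rule. If the right
    side is finite, so are almost all fibre entropies of [T], hence those of
    [T'], which gives the absolute continuity that the chain rule for [T']
    requires. *)
Lemma relative_entropy_kernel_product_le T' T S : countably_generated Z ->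
  {ae pi, forall w, relative_entropy (kernel_at T' w) (kernel_at S w) <=
                    relative_entropy (kernel_at T w) (kernel_at S w)} ->
  relative_entropy (kernel_product pi T') (kernel_product pi S) <=
  relative_entropy (kernel_product pi T) (kernel_product pi S).
Proof.
move=> cgZ T'T.
have [->|] := eqVneq
    (relative_entropy (kernel_product pi T) (kernel_product pi S)) +oo.
  exact: leey.
rewrite -ltey => fin_T.
have [h [h0 mh hE intE]] :=
  relative_entropy_chain_rule cgZ (relative_entropy_lty_dominates fin_T).
have h_fin : {ae pi, forall w, h w < +oo}.
  have : pi.-integrable setT h.
    apply/integrableP; split => //; under eq_integral do rewrite gee0_abs//.
    by rewrite -intE lte_add_pinfty// ltry.
  move=> /integrable_ae -/(_ measurableT); apply: filterS => w /(_ I).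
  by rewrite ge0_fin_numE.
have T'_dom : kernel_product pi T' `<< kernel_product pi S.
  apply: kernel_product_dominates.
  apply: filterS3 T'T hE h_fin => w le_w hw hfin.
  apply: relative_entropy_lty_dominates; apply: le_lt_trans le_w _.
  by rewrite ltey; apply: contraTneq hfin => e; rewrite -hw e.
have [h' [h'0 mh' h'E int'E]] := relative_entropy_chain_rule cgZ T'_dom.
rewrite -(@leeD2rE _ 1)// intE int'E.
apply: ae_ge0_le_integral => //; apply: filterS3 T'T hE h'E => w le_w <- <- _.
exact: leeD2r.
Qed.

End entropy_chain_rule.

Theorem proposition3p1 (R : realType) (dU dV dX dY : measure_display)
    (U : measurableType dU) (V : measurableType dV)
    (X : measurableType dX) (Y : measurableType dY)
    (cgX : countably_generated X) (cgY : countably_generated Y)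
    (i : probability U R) (j : probability V R)
    (P : R.-pker U ~> X) (Q : R.-pker V ~> Y)
    (J : R.-pker U ~> V)
    (iJ : forall A : set V, measurable A -> \int[i]_u J u A = j A)
    (B : U -> V -> R.-pker X ~> Y)
    (PB : forall (u : U) (v : V) (A : set Y), measurable A ->
      \int[P u]_x B u v x A = Q v A)
    (Pi : R.-pker (U * V) ~> (X * Y)%type)
    (PiE : forall (u : U) (v : V) (A : set (X * Y)), measurable A ->
      Pi (u, v) A = kernel_product (kernel_at P u) (B u v) A)
    (K : R.-pker X ~> Y) :
  let pi := kernel_product i J in
  let Rk : R.-pker (U * V) ~> (X * Y)%type := reference_kernel P K in
  {ae pi, forall w : U * V,
    argmin [set T : R.-pker (U * V) ~> (X * Y)%type |
             has_marginals P Q T w.1 w.2]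
           (fun T => relative_entropy (kernel_at T w) (kernel_at Rk w))
           Pi} ->
  relative_entropy (kernel_product pi Pi) (kernel_product pi Rk) =
  ereal_inf
    [set relative_entropy (kernel_product pi T) (kernel_product pi Rk) |
      T in [set T : R.-pker (U * V) ~> (X * Y)%type |
             forall (u : U) (v : V), has_marginals P Q T u v]].
Proof.
move=> pi Rk Pi_min; apply/eqP; rewrite eq_le; apply/andP; split.
- apply: le_ereal_inf_tmp => _ [T T_marg <-].
  apply: relative_entropy_kernel_product_le.
    exact: countably_generated_prod.
  apply: filterS Pi_min => w [_]; apply; exact: T_marg.
- apply: ereal_inf_lbound; exists Pi => // u v; split => A mA.
  + rewrite PiE ?kernel_product_setX//; last exact: measurableX.
    rewrite (eq_integral (cst 1)); last by move=> x _; rewrite prob_kernel.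
    by rewrite integral_cst// mul1e.
  + rewrite PiE ?kernel_product_setX//; last exact: measurableX.
    exact: PB.
Qed.
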